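(* Let $\Bbbk$ be a field of characteristic $0$. (1) If $G$ is a graph with $n$ vertices and $\tau(G)>n/2$, then $A_{\mathrm c}(G)$ has the weak Lefschetz property (WLP). (2) Let $p\in[0,1]$ be a constant. Let $G_{n,p}$ denote the Erdős–Rényi random graph on the vertex set $[n]$ (each pair of distinct vertices is joined by an edge independently with probability $p$), and let $\mathcal G_n$ denote a random isomorphism class of graphs on $n$ vertices, chosen uniformly among all isomorphism classes of graphs on $n$ vertices. Then $$\lim_{n\to\infty}\mathbb P\big(A_{\mathrm c}(G_{n,p})\text{ has the WLP}\big)=\lim_{n\to\infty}\mathbb P\big(A_{\mathrm c}(\mathcal G_n)\text{ has the WLP}\big)=1 .$$
   Context: $[n]=\{1,\dots,n\}$. Graphs are finite and simple; in (1) they have at least one edge. A vertex cover of $G$ is a set $C$ of vertices meeting every edge; $\tau(G)$ is the minimum cardinality of a vertex cover. For a graph $G$ with vertex set $[n]$, let $R=\Bbbk[x_1,\dots,x_n]$ with the standard grading, $x_C=\prod_{i\in C}x_i$, let $J(G)=(x_C : C\text{ a vertex cover of }G)\subset R$ be the cover ideal, and $A_{\mathrm c}(G)=R/\big((x_1^2,\dots,x_n^2)+J(G)\big)$. Up to isomorphism this depends only on the isomorphism class of $G$. (In (2), if the random graph has no edge, the empty set is a vertex cover, so $J(G)=R$ and $A_{\mathrm c}(G)=0$, which has the WLP trivially.) A standard graded Artinian $\Bbbk$-algebra $A=\bigoplus_i [A]_i$ has the WLP if there is a linear form $\ell\in[A]_1$ such that for every $i$ the multiplication map $\cdot\ell:[A]_i\to[A]_{i+1}$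 is injective or surjective. *)

(* Defs.v *)
From HB Require Import structures.
From mathcomp Require Import all_boot all_order all_fingroup all_algebra.
From mathcomp Require Import generic_quotient ring_quotient mpoly.
From mathcomp Require Import boolp classical_sets.

Set Implicit Arguments.
Unset Strict Implicit.
Unset Printing Implicit Defensive.

Import GRing.Theory.

Local Open Scope ring_scope.
Local Open Scope quotient_scope.

Section Quotient_by_generated_ideal.
Variable R : comNzRingType.
Implicit Type S : set R.

Definition ideal_gen S : {pred R} := fun f =>
  `[< exists s : seq (R * R),
        (forall u, u \in s -> S u.2) /\ f = \sum_(u <- s) u.1 * u.2 >].

Lemma ideal_genM S (a f : R) : f \in ideal_gen S -> a * f \in ideal_gen S.
Proof.
move=> /asboolP[s [sS ->]]; apply/asboolP.
exists [seq (a * u.1, u.2) | u <- s]; split=> [u /mapP[v vs ->]|]; first exact: (sS _ vs).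
by rewrite big_map mulr_sumr; apply: eq_bigr => u _; rewrite mulrA.
Qed.

Lemma ideal_gen_zmod_closed S : zmod_closed (ideal_gen S).
Proof.
split=> [|f g fI gI]; first by apply/asboolP; exists [::]; rewrite big_nil.
have : - g \in ideal_gen S by rewrite -mulN1r ideal_genM.
move: fI => /asboolP[s [sS ->]] /asboolP[t [tS ->]]; apply/asboolP.
exists (s ++ t); rewrite big_cat; split=> // u.
by rewrite mem_cat => /orP[/sS|/tS].
Qed.

HB.instance Definition _ S :=
  GRing.isZmodClosed.Build R (ideal_gen S) (ideal_gen_zmod_closed S).

(* The library makes [{ideal_quot I}] a ring only for proper [I]; here the ideal
   may be improper, in which case the quotient is the zero ring. *)
Definition ring_quot S : Type := Quotient.quot (ideal_gen S : zmodClosed R).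

HB.instance Definition _ S := GRing.Zmodule.on (ring_quot S).
HB.instance Definition _ S := EqQuotient.on (ring_quot S).

Definition ring_quot_pi S (f : R) : ring_quot S := \pi f.

Definition ring_quot_one S : ring_quot S := ring_quot_pi S 1.

Definition ring_quot_mul S (a b : ring_quot S) : ring_quot S :=
  ring_quot_pi S (repr a * repr b).

Lemma ring_quot_piP S (f g : R) :
  ring_quot_pi S f = ring_quot_pi S g <-> f - g \in ideal_gen S.
Proof.
by rewrite Quotient.idealrBE; split=> [/eqP//|/eqP].
Qed.

Lemma repr_ring_quot_pi S (a : ring_quot S) : ring_quot_pi S (repr a) = a.
Proof. exact: reprK. Qed.

Lemma ring_quot_piD S : {morph ring_quot_pi S : f g / f + g}.
Proof. exact: Quotient.pi_add. Qed.

Lemma ring_quot_piM S (f g : R) :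
  ring_quot_pi S (f * g) = ring_quot_mul (ring_quot_pi S f) (ring_quot_pi S g).
Proof.
rewrite /ring_quot_mul; set f' := repr _; set g' := repr _.
have fP : f - f' \in ideal_gen S.
  by apply/ring_quot_piP; rewrite repr_ring_quot_pi.
have gP : g - g' \in ideal_gen S.
  by apply/ring_quot_piP; rewrite repr_ring_quot_pi.
apply/ring_quot_piP.
have -> : f * g - f' * g' = g * (f - f') + f' * (g - g').
  by rewrite !mulrBr addrA [g * f]mulrC [g * f']mulrC subrK.
by rewrite rpredD // ideal_genM.
Qed.

Lemma ring_quot_mulA S : associative (@ring_quot_mul S).
Proof.
move=> a b c.
rewrite -[a]repr_ring_quot_pi -[b]repr_ring_quot_pi -[c]repr_ring_quot_pi.
by rewrite -!ring_quot_piM mulrA.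
Qed.

Lemma ring_quot_mulC S : commutative (@ring_quot_mul S).
Proof. by move=> a b; rewrite /ring_quot_mul mulrC. Qed.

Lemma ring_quot_mul1 S : left_id (ring_quot_one S) (@ring_quot_mul S).
Proof.
by move=> a; rewrite -[a]repr_ring_quot_pi -ring_quot_piM mul1r.
Qed.

Lemma ring_quot_mulDl S : left_distributive (@ring_quot_mul S) +%R.
Proof.
move=> a b c.
rewrite -[a]repr_ring_quot_pi -[b]repr_ring_quot_pi -[c]repr_ring_quot_pi.
by rewrite -ring_quot_piD -!ring_quot_piM mulrDl ring_quot_piD.
Qed.

HB.instance Definition _ S := GRing.Zmodule_isComPzRing.Build (ring_quot S)
  (@ring_quot_mulA S) (@ring_quot_mulC S) (@ring_quot_mul1 S)
  (@ring_quot_mulDl S).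

End Quotient_by_generated_ideal.

(* [gr i] is the degree-[i] component of the graded algebra [A]. *)
Definition WLP (A : comPzRingType) (gr : nat -> set A) : Prop :=
  exists l : A, gr 1%N l /\
    forall i : nat,
      (forall a b : A, gr i a -> gr i b -> l * a = l * b -> a = b) \/
      (forall b : A, gr i.+1 b -> exists a : A, gr i a /\ l * a = b).

Section Graphs.
Variable n : nat.

Record sgraph := SGraph {
  edges : {set {set 'I_n}};
  edges_pairs : [forall e in edges, #|e| == 2]
}.

HB.instance Definition _ := [isSub for edges].
HB.instance Definition _ := [Finite of sgraph by <:].

Implicit Types (G H : sgraph) (C : {set 'I_n}).

Definition vertex_cover G C : bool :=
  [forall e in edges G, C :&: e != finset.set0].

Definition tau G : nat :=
  #|[arg min_(C < [set: 'I_n]%SET | vertex_cover G C) #|C|]|.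

Lemma vertex_cover_setT G : vertex_cover G [set: 'I_n]%SET.
Proof.
apply/forall_inP => e eG; rewrite finset.setTI -card_gt0.
by have /forall_inP/(_ e eG)/eqP -> := edges_pairs G.
Qed.

Definition graph_iso : rel sgraph := fun G H =>
  [exists s : 'S_n, edges H == [set s @: (e : {set 'I_n}) | e in edges G]%SET].

Definition iso_classes : {set {set sgraph}} :=
  equivalence_partition graph_iso [set: sgraph]%SET.

End Graphs.

Section Cover_algebra.
Variables (k : fieldType) (n : nat) (G : sgraph n).

Definition cover_ideal : {pred {mpoly k[n]}} :=
  ideal_gen [set f | exists2 C, vertex_cover G C & f = \prod_(i in C) 'X_i].

(* The sum of the ideals [(x_1^2, .., x_n^2)] and [J(G)] is generated by their
   union. *)
Definition Ac : comPzRingType :=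
  ring_quot ([set f | exists i : 'I_n, f = 'X_i ^+ 2] `|` [set` cover_ideal])%classic.

Definition Ac_gr (d : nat) : set Ac :=
  [set a | exists2 f : {mpoly k[n]}, f \is d.-homog & a = ring_quot_pi _ f]%classic.

Definition Ac_WLP : Prop := WLP Ac_gr.

End Cover_algebra.

Section Random_graphs.
Variable R : numFieldType.

(* The product Bernoulli([p]) law over the unordered pairs of vertices. *)
Definition Gnp_weight n (p : R) (G : sgraph n) : R :=
  \prod_(e : {set 'I_n} | #|e| == 2) (if e \in edges G then p else 1 - p).

Definition Gnp_prob n (p : R) (P : sgraph n -> Prop) : R :=
  \sum_(G : sgraph n | `[< P G >]) Gnp_weight p G.

(* A class has the property when all its members do; for the
   isomorphism-invariant [P] used here this is the same as for one member. *)
Definition iso_class_prob n (P : sgraph n -> Prop) : R :=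
  #|[set c in iso_classes n | [forall G in c, `[< P G >]]]%SET|%:R
    / #|iso_classes n|%:R.

End Random_graphs.

(* Main.v *)
(* A monomial basis of [Ac k G] is given by the squarefree monomials [x_S] with
   [S] not a vertex cover, so multiplication by [x_1 + .. + x_n] is, up to size
   [tau G - 1], the up operator [U] of the Boolean lattice, and a quotient of it
   beyond.  With the down operator [D], [D U - U D] acts on level [m] as
   [n - 2 m]; this sl2-relation makes [U] injective below the middle and
   surjective above it in characteristic 0, and [tau G > n / 2] puts every
   truncated level in the surjective range.

   If [tau G <= n / 2], then [G] has an independent set of size at least [n / 2];
   for [p > 0] the union bound gives probability at most
   [2 ^ n (1 - p) ^ 'C(n / 2, 2)].  A class not having the WLP contains a bad
   labelled graph and a class has at most [n!] members, so for random classes the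
   bound at [p = 1 / 2] only grows by the factor [n!], which is still negligible. *)
Require Import Defs.
From HB Require Import structures.
From mathcomp Require Import all_boot all_order all_fingroup all_algebra ring zify lra.
From mathcomp Require Import boolp classical_sets.
From mathcomp Require mpoly.
Set Implicit Arguments.
Unset Strict Implicit.
Unset Printing Implicit Defensive.
Import Order.TTheory GRing.Theory Num.Theory.
Local Open Scope ring_scope.

(** * The weak Lefschetz property of the Boolean lattice *)

Section Sl2.
Variables (k : fieldType) (V : lmodType k) (X Y : {linear V -> V}) (H : V -> V).
Hypothesis XY : forall v, X (Y v) = Y (X v) + H v.
Hypothesis HY : forall v, H (Y v) = Y (H v) - Y v *+ 2.

Lemma weight_iter c g j : H g = c *: g ->
  H (iter j Y g) = (c - (j * 2)%N%:R) *: iter j Y g.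
Proof.
move=> Hg; elim: j => [|j IH]; first by rewrite subr0.
rewrite iterS HY IH linearZ /= -scaler_nat -scalerBl mulSn natrD.
by congr (_ *: _); ring.
Qed.

(** Moving [X] past each [Y] in turn picks up the weights c, c - 2, ..., c - 2j, whose sum is (j +
    1)(c - j). *)
Lemma comm_iter c g j : H g = c *: g ->
  X (iter j.+1 Y g) = iter j.+1 Y (X g) + (j.+1%:R * (c - j%:R)) *: iter j Y g.
Proof.
move=> Hg; elim: j => [|j IH]; first by rewrite /= XY Hg subr0 mul1r.
rewrite iterS XY IH (weight_iter _ Hg) linearD linearZ -!iterS.
rewrite -addrA -scalerDl; congr (_ + _ *: _).
by rewrite -!natr1 natrM; ring.
Qed.

(** When [X g = 0], [comm_iter] says that [X] sends Y^(N+1) g to a nonzero multiple of Y^N g. So the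
    vanishing of Y^(N+1) g forces that of Y^N g, and one descends to [g] itself. *)
Lemma iter_nilp_inj c g N : H g = c *: g ->
  (forall j : nat, c - j%:R != 0) -> (forall j : nat, j.+1%:R != 0 :> k) ->
  iter N Y g = 0 -> X g = 0 -> g = 0.
Proof.
move=> Hg cN0 nat0; elim: N => [//|N IH] YN Xg; apply: IH => //.
have := comm_iter N Hg; rewrite YN Xg.
have -> : iter N.+1 Y 0 = 0 by elim: (N.+1) => //= m ->; rewrite linear0.
rewrite linear0 add0r => /esym/eqP; rewrite scaler_eq0 mulf_eq0.
by rewrite (negPf (nat0 _)) (negPf (cN0 _)) => /eqP.
Qed.

(** X^N Y^N g is a nonzero multiple of [g] up to an element of the image of [Y]; as it also
    vanishes, [g] lies in that image. *)
Lemma iter_nilp_surj c g N : H g = c *: g ->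
  (forall v, H (X v) = X (H v) + X v *+ 2) ->
  (forall j : nat, c - j%:R != 0) -> (forall j : nat, j.+1%:R != 0 :> k) ->
  iter N Y g = 0 -> exists h, Y h = g.
Proof.
move=> Hg HX cN0 nat0 YN.
have iterXD j : {morph iter j X : u v / u + v}.
  by elim: j => // j IH u v; rewrite !iterS IH linearD.
have iterXZ j a u : iter j X (a *: u) = a *: iter j X u.
  by elim: j => //= j ->; rewrite linearZ.
(* Modulo the image of [Y], [X^N Y^N] acts on weight vectors as a nonzero scalar. *)
have [d d0 key] : exists2 d : k, d != 0 & forall g, H g = c *: g ->
    exists h, iter N X (iter N Y g) = d *: g + Y h.
  elim: (N) => [|j [d d0 IH]].
    by exists 1; rewrite ?oner_neq0 // => u _; exists 0; rewrite linear0 scale1r addr0.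
  exists (j.+1%:R * (c - j%:R) * d); first by rewrite !mulf_neq0.
  move=> u Hu.
  (* [Y (X u)] has the same weight as [u], so the induction hypothesis applies to both; commuting
     one [X] through Y^(j+1) produces exactly these two terms. *)
  have HYX : H (Y (X u)) = c *: Y (X u).
    rewrite HY HX Hu linearD linearZ /= [Y (X u *+ 2)]linearMn linearZ /=.
    by rewrite addrK.
  have [h1 e1] := IH _ HYX; have [h2 e2] := IH _ Hu.
  exists (d *: X u + h1 + (j.+1%:R * (c - j%:R)) *: h2).
  rewrite iterSr (comm_iter _ Hu) iterXD iterXZ iterSr e1 e2.
  rewrite scalerDr scalerA !linearD !linearZ /=.
  by rewrite addrC -!addrA; congr (_ + _); rewrite addrC addrA.
have [h e] := key _ Hg.
have i0 : iter N X 0 = 0 by elim: (N) => //= m ->; rewrite linear0.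
exists (- d^-1 *: h); rewrite linearZ /=.
move: e; rewrite YN i0 => /esym/eqP; rewrite addr_eq0 => /eqP e.
by rewrite scaleNr -scalerN -e scalerA mulVf // scale1r.
Qed.

End Sl2.

(** * The sl2-action on functions on the subsets of [n] *)

Section Boolean_lattice.
Variables (n : nat) (k : fieldType).
Notation V := {ffun {set 'I_n} -> k^o}.
Implicit Types (f g : V) (S : {set 'I_n}).

(** Reading a function on subsets as the coefficients of squarefree monomials, [up] is
    multiplication by x_1 + ... + x_n modulo the squares and [down] is the sum of the partial
    derivatives. All degrees share one space, so that the operators are endomorphisms. *)
Definition up f : V := [ffun S : {set 'I_n} => \sum_(i in S) f (S :\ i)%SET].
Definition down f : V := [ffun S : {set 'I_n} => \sum_(i | i \notin S) f (i |: S)%SET].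
Definition weight f : V :=
  [ffun S : {set 'I_n} => (n%:R - (#|S| * 2)%N%:R) * f S].

Fact up_is_linear : linear up.
Proof.
move=> a f g; apply/ffunP => S; rewrite !ffunE scaler_sumr -big_split.
by apply: eq_bigr => i _; rewrite !ffunE.
Qed.
HB.instance Definition _ := GRing.isLinear.Build k V V *:%R up up_is_linear.

Fact down_is_linear : linear down.
Proof.
move=> a f g; apply/ffunP => S; rewrite !ffunE scaler_sumr -big_split.
by apply: eq_bigr => i _; rewrite !ffunE.
Qed.
HB.instance Definition _ := GRing.isLinear.Build k V V *:%R down down_is_linear.

(** Adding i and removing j commute when i differs from j, so these terms cancel. The diagonal terms
    contribute n - |S| copies of [f S] on one side and |S| on the other. *)
Lemma down_up f : down (up f) = up (down f) + weight f.
Proof.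
apply/ffunP => S; rewrite !ffunE.
under eq_bigr => i iS.
  rewrite ffunE big_setU1 //= finset.setU1K //.
  under eq_bigr => j jS.
    rewrite (_ : (i |: S) :\ j = i |: (S :\ j))%SET; last first.
      apply/setP => x; rewrite !inE; case: (eqVneq x i) => [->|] //=.
      by rewrite andbT; apply: contraNN iS => /eqP ->.
    over.
  over.
rewrite big_split /= sumr_const.
under [in RHS]eq_bigr => j jS.
  rewrite ffunE (bigD1 j) ?inE ?eqxx //= finset.setD1K //.
  under eq_bigl => i.
    rewrite !inE negb_and negbK (_ : _ && _ = (i \notin S)); last first.
      by case: (eqVneq i j) => [->|]; rewrite ?jS //= andbT.
    over.
  over.
rewrite big_split /= sumr_const exchange_big /= addrC -!addrA [RHS]addrCA.
congr (_ + _).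
have -> : n%:R = #|S|%:R + #|[pred i | i \notin S]|%:R :> k.
  by rewrite -natrD cardC card_ord.
rewrite -![f S *+ _]mulr_natl natrM; move: #|S| #|_| (f S : k) => a b x; ring.
Qed.

Lemma weight_up f : weight (up f) = up (weight f) - up f *+ 2.
Proof.
rewrite -scaler_nat; apply/ffunP => S; rewrite !ffunE.
rewrite -[_ *: \sum_(_ in _) _]/(_ * _) -mulNr !mulr_sumr -big_split /=.
apply: eq_bigr => i iS; rewrite ffunE (cardsD1 i S) iS add1n mulSn natrD.
by move: (#|_| * 2)%N (f _ : k) => a x; ring.
Qed.

Lemma weight_down f : weight (down f) = down (weight f) + down f *+ 2.
Proof.
rewrite -scaler_nat; apply/ffunP => S; rewrite !ffunE.
rewrite -[_ *: \sum_(_ | _) _]/(_ * _) !mulr_sumr -big_split /=.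
apply: eq_bigr => i iS; rewrite ffunE cardsU1 iS add1n mulSn natrD.
by move: (#|_| * 2)%N (f _ : k) => a x; ring.
Qed.

Lemma iter_up_eq0 j f S : (#|S| < j)%N -> iter j up f S = 0.
Proof.
elim: j S => // j IH S Sj; rewrite iterS ffunE big1 // => i iS; apply: IH.
by move: Sj; rewrite (cardsD1 i S) iS.
Qed.

Lemma iter_down_eq0 j f S : (n < #|S| + j)%N -> iter j down f S = 0.
Proof.
elim: j S => [|j IH] S Sj.
  by move: Sj; rewrite addn0 ltnNge -[X in (_ <= X)%N]card_ord max_card.
rewrite iterS ffunE big1 // => i iS; apply: IH.
by rewrite cardsU1 iS add1n addSnnS.
Qed.

Definition homogeneous m f := forall S, #|S| != m -> f S = 0.

Lemma weight_homogeneous m f : homogeneous m f ->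
  weight f = (n%:R - (m * 2)%N%:R) *: f.
Proof.
move=> fm; apply/ffunP => S; rewrite !ffunE.
by have [->|/fm->] := eqVneq #|S| m; rewrite // mulr0 scaler0.
Qed.

Hypothesis k0 : [pchar k] =i pred0.

Let natrN0 j : j.+1%:R != 0 :> k.
Proof. by rewrite (pcharf0P _).1. Qed.

Lemma up_inj m f : (m * 2 < n)%N -> homogeneous m f -> up f = 0 -> f = 0.
Proof.
move=> mn fm; have Hf := weight_homogeneous fm.
(* For injectivity [down] plays the nilpotent [Y]; exchanging the two operators flips the sign of
   the commutator. The weight 2m - n is then negated to n - 2m with respect to [weight], and
   nonvanishing of c - j comes from c = 2m - n being negative. *)
pose H g := - weight g.
have XY g : up (down g) = down (up g) + H g by rewrite down_up addrK.
have HY g : H (down g) = down (H g) - down g *+ 2.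
  by rewrite /H weight_down linearN /= opprD.
have cN0 j : - (n%:R - (m * 2)%N%:R) - j%:R != 0 :> k.
  rewrite (_ : _ - _ = - ((n - m * 2).-1.+1 + j)%N%:R).
    by rewrite oppr_eq0 addSn natrN0.
  by rewrite prednK ?subn_gt0 // natrD natrB 1?ltnW // [RHS]opprD.
apply: (iter_nilp_inj XY HY (c := - (n%:R - (m * 2)%N%:R)) (N := n.+1)) => //.
  by rewrite /H Hf scaleNr.
by apply/ffunP => S; rewrite iter_down_eq0 ?ffunE // ltn_addl.
Qed.

(** Here [up] plays the nilpotent [Y], and the weight n - 2m is negative. The preimage is not
    claimed homogeneous; its component of the right degree is extracted later by [sqfree_poly]. *)
Lemma up_surj m f : (n < m * 2)%N -> homogeneous m f -> exists g, up g = f.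
Proof.
move=> mn fm.
have cN0 j : (n%:R - (m * 2)%N%:R) - j%:R != 0 :> k.
  rewrite (_ : _ - _ = - ((m * 2 - n).-1.+1 + j)%N%:R).
    by rewrite oppr_eq0 addSn natrN0.
  by rewrite prednK ?subn_gt0 // natrD natrB 1?ltnW // [RHS]opprD opprB.
apply: (iter_nilp_surj down_up weight_up (weight_homogeneous fm)
          weight_down cN0 natrN0 (N := n.+1)).
apply/ffunP => S; rewrite iter_up_eq0 ?ffunE // ltnS.
by rewrite -[X in (_ <= X)%N]card_ord max_card.
Qed.

End Boolean_lattice.

(** * The monomial basis of the cover algebra *)

Lemma mem_ideal_gen (R : comNzRingType) (S : set R) f : S f -> f \in ideal_gen S.
Proof.
move=> Sf; apply/asboolP; exists [:: (1, f)].
by split=> [u|]; rewrite ?inE ?big_seq1 ?mul1r // => /eqP ->.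
Qed.

Lemma vertex_coverS n (G : sgraph n) (C D : {set 'I_n}) :
  C \subset D -> vertex_cover G C -> vertex_cover G D.
Proof.
move=> CD /forall_inP GC; apply/forall_inP => e /GC.
by rewrite -!card_gt0 => /leq_trans; apply; rewrite subset_leq_card // finset.setSI.
Qed.

Lemma vertex_cover_card n (G : sgraph n) C : vertex_cover G C -> (tau G <= #|C|)%N.
Proof.
rewrite /tau; case: arg_minnP => [|D _ Dmin]; [exact: vertex_cover_setT|exact: Dmin].
Qed.

Section Monomial_basis.
Import mpoly.
Variables (k : fieldType) (n : nat) (G : sgraph n).
Implicit Types (f g : {mpoly k[n]}) (S C : {set 'I_n}).

Definition sqfree_mnm S : 'X_{1.. n} := [multinom (i \in S : nat) | i < n].

Lemma mdeg_sqfree S : mdeg (sqfree_mnm S) = #|S|.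
Proof.
rewrite mdegE -sum1_card [RHS]big_mkcond; apply: eq_bigr => i _.
by rewrite mnmE; case: (i \in S).
Qed.

Lemma sqfree_mnm_inj : injective sqfree_mnm.
Proof.
move=> S T /mnmP e; apply/setP => i; have := e i; rewrite !mnmE.
by case: (i \in S); case: (i \in T).
Qed.

Lemma prod_varE C : \prod_(i in C) 'X_i = 'X_[sqfree_mnm C] :> {mpoly k[n]}.
Proof.
rewrite [RHS]mpolyXE_id big_mkcond; apply: eq_bigr => i _.
by rewrite mnmE; case: (i \in C).
Qed.

Lemma mcoeffMX_nle f m m' : ~~ (m <= m')%MM -> (f * 'X_[m])@_m' = 0.
Proof.
move=> nle; apply: memN_msupp_eq0; rewrite (perm_mem (msuppMX f m)).
apply: contra nle => /mapP[m1 _ ->]; apply/mnm_lepP => i.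
by rewrite mnmDE leq_addr.
Qed.

(** This identifies multiplication by the sum of the variables, on squarefree coefficients, with
    [up]. *)
Lemma mcoeff_sumXM f S : ((\sum_i 'X_i) * f)@_(sqfree_mnm S) =
  \sum_(i in S) f@_(sqfree_mnm (S :\ i)%SET).
Proof.
rewrite mulr_suml raddf_sum [RHS]big_mkcond; apply: eq_bigr => i _ /=.
rewrite mulrC; case: ifPn => iS; last first.
  by rewrite mcoeffMX_nle // lep1mP mnmE (negPf iS).
rewrite (_ : sqfree_mnm S = U_(i) + sqfree_mnm (S :\ i)%SET)%MM ?mcoeffMX //.
apply/mnmP => j; rewrite mnmDE mnm1E !mnmE !inE.
by have [<-|] := eqVneq i j; rewrite ?iS.
Qed.

Local Notation relations :=
  ([set f | exists i : 'I_n, f = 'X_i ^+ 2] `|` [set` @cover_ideal k n G])%classic.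

(** No generator divides x_S: squares do not because x_S is squarefree, and x_C does not because a
    set containing a cover is a cover. *)
Lemma ideal_mcoeff_eq0 f S : f \in ideal_gen relations -> ~~ vertex_cover G S ->
  f@_(sqfree_mnm S) = 0.
Proof.
move=> /asboolP[s [sP ->]] ncS; rewrite raddf_sum big1_seq //= => -[a g] us.
have /= [[i ->]|] := sP _ us.
  rewrite mpolyXn mcoeffMX_nle //; apply/mnm_lepP => /(_ i).
  by rewrite mulmnE mnm1E eqxx mnmE; case: (i \in S).
move=> /asboolP[t [tP ->]]; rewrite mulr_sumr raddf_sum big1_seq //=.
move=> -[b h] vt; have /= [C cC ->] := tP _ vt.
rewrite prod_varE mulrA mcoeffMX_nle //; apply: contra ncS => /mnm_lepP le.
apply: vertex_coverS cC; apply/fintype.subsetP => i iC.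
by have := le i; rewrite !mnmE iC; case: (i \in S).
Qed.

(** The ideal is monomial, so membership is tested term by term: a monomial has an exponent at least
    2, or is x_S with S a cover, or has coefficient zero by hypothesis. *)
Lemma mem_idealP f : reflect
  (forall S, ~~ vertex_cover G S -> f@_(sqfree_mnm S) = 0)
  (f \in ideal_gen relations).
Proof.
apply: (iffP idP) => [fI S|f0]; first exact: ideal_mcoeff_eq0.
rewrite [f]mpolyE rpred_sum // => m _; rewrite -mul_mpolyC.
case: (pickP (fun i => 1 < m i)%N) => [i mi|m1].
  rewrite -(submK (_ : U_(i) *+ 2 <= m)%MM); last first.
    by apply/mnm_lepP => j; rewrite mulmnE mnm1E; case: eqVneq => [<-|].
  rewrite mpolyXD mulrA; apply/ideal_genM/mem_ideal_gen; left.
  by exists i; rewrite mpolyXn.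
pose S : {set 'I_n} := [set i | m i != 0]%SET.
have mE : m = sqfree_mnm S.
  apply/mnmP => i; rewrite mnmE inE; have := m1 i.
  by case: (m i) => [|[]].
have [cS|/f0] := boolP (vertex_cover G S); last first.
  by rewrite -mE => ->; rewrite mpolyC0 mul0r rpred0.
apply/ideal_genM/mem_ideal_gen; right; apply: mem_ideal_gen.
by exists S; rewrite // mE prod_varE.
Qed.

Lemma Ac_pi_eq f g : ring_quot_pi relations f = ring_quot_pi relations g <->
  forall S, ~~ vertex_cover G S -> f@_(sqfree_mnm S) = g@_(sqfree_mnm S).
Proof.
split=> [/ring_quot_piP/mem_idealP fg S ncS|fg].
  by have /eqP := fg S ncS; rewrite mcoeffB subr_eq0 => /eqP.
apply/ring_quot_piP/mem_idealP => S ncS.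
by rewrite mcoeffB fg // subrr.
Qed.

Lemma Ac_piM f g : (ring_quot_pi _ f : Ac k G) * (ring_quot_pi _ g : Ac k G) =
  ring_quot_pi _ (f * g).
Proof. by rewrite ring_quot_piM. Qed.

(** Every set is a cover, so the algebra is zero. This serves the case p = 0 of the random graph,
    where [tau G] is 0. *)
Lemma Ac_WLP_no_edge : edges G = finset.set0 -> Ac_WLP k G.
Proof.
move=> G0.
have cov S : vertex_cover G S.
  by apply/forall_inP => e; rewrite G0 inE.
have triv (a b : Ac k G) : a = b.
  rewrite -[a]repr_ring_quot_pi -[b]repr_ring_quot_pi.
  by apply/Ac_pi_eq => S; rewrite cov.
exists 0; split=> [|i]; last by left.
by exists 0; [exact: dhomog0|exact: triv].
Qed.

Definition sqfree_poly (h : {ffun {set 'I_n} -> k^o}) m : {mpoly k[n]} :=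
  \sum_(S : {set 'I_n} | #|S| == m) (h S : k) *: 'X_[sqfree_mnm S].

Lemma sqfree_poly_homog h m : sqfree_poly h m \is m.-homog.
Proof.
by apply: rpred_sum => S Sm; rewrite rpredZ // dhomogX /= mdeg_sqfree.
Qed.

Lemma mcoeff_sqfree_poly h m S : #|S| = m ->
  (sqfree_poly h m)@_(sqfree_mnm S) = h S.
Proof.
move=> Sm; rewrite raddf_sum (bigD1 S) ?Sm //= mcoeffZ mcoeffX eqxx mulr1.
rewrite big1 ?addr0 // => T /andP[_ TS].
by rewrite mcoeffZ mcoeffX (inj_eq sqfree_mnm_inj) (negPf TS) mulr0.
Qed.

Definition sqfree_coef f : {ffun {set 'I_n} -> k^o} :=
  [ffun S => f@_(sqfree_mnm S)].

Lemma homog_mcoeff_eq0 f m S : f \is m.-homog -> #|S| != m ->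
  f@_(sqfree_mnm S) = 0.
Proof. by move=> /dhomog_nemf_coeff fm; rewrite -mdeg_sqfree => /fm. Qed.

Hypothesis k0 : [pchar k] =i pred0.

Lemma Ac_WLP_tau : (n < tau G * 2)%N -> Ac_WLP k G.
Proof.
move=> tauG; pose l : {mpoly k[n]} := \sum_i 'X_i.
have l_homog : l \is 1.-homog.
  by apply: rpred_sum => i _; rewrite dhomogX /= mdeg1.
exists (ring_quot_pi _ l); split=> [|d]; first by exists l.
(* The threshold is 2d + 2 <= n, so that d + 1 < [tau G]: all sets of size d + 1 are then
   non-covers, and degree d + 1 of the quotient retains every squarefree coefficient. The middle
   case n = 2d + 1 goes to the surjective side. *)
have [dn|nd] := ltnP d.*2.+1 n.
  left=> _ _ [f fd ->] [g gd ->]; rewrite !Ac_piM => /Ac_pi_eq e.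
  have fg0 : sqfree_coef (f - g) = 0.
    apply: (@up_inj _ _ k0 d) => [||]; first by rewrite muln2 ltnW.
      by move=> S Sd; rewrite ffunE mcoeffB !(homog_mcoeff_eq0 _ Sd) ?subrr.
    apply/ffunP => S; rewrite !ffunE.
    under eq_bigr do rewrite ffunE.
    rewrite -mcoeff_sumXM.
    have [Sd|Sd] := eqVneq #|S| d.+1.
      rewrite mulrBr mcoeffB e ?subrr //.
      by apply/negP => /vertex_cover_card; lia.
    by rewrite mulrBr mcoeffB !(homog_mcoeff_eq0 _ Sd) ?subrr // -add1n dhomogM.
  apply/Ac_pi_eq => S _; move/ffunP/(_ S)/eqP: fg0; rewrite !ffunE mcoeffB.
  by rewrite subr_eq0 => /eqP.
right=> _ [g gd ->].
have [|S Sd|h hg] := @up_surj n k k0 d.+1 (sqfree_coef g); first by lia.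
  by rewrite ffunE (homog_mcoeff_eq0 gd Sd).
(* Only the values of [h] on sets of size d affect the product in degree d + 1, so the rest of [h]
   can be cut off. *)
exists (ring_quot_pi _ (sqfree_poly h d)); split.
  by exists (sqfree_poly h d); rewrite // sqfree_poly_homog.
rewrite Ac_piM; apply/Ac_pi_eq => S _; rewrite mcoeff_sumXM.
have [Sd|Sd] := eqVneq #|S| d.+1.
  move/ffunP/(_ S): hg; rewrite !ffunE => <-.
  apply: eq_bigr => i iS; rewrite mcoeff_sqfree_poly //.
  by move: Sd; rewrite (cardsD1 i) iS => -[].
rewrite -mcoeff_sumXM (homog_mcoeff_eq0 _ Sd) ?(homog_mcoeff_eq0 gd) //.
by rewrite -add1n dhomogM // sqfree_poly_homog.
Qed.

End Monomial_basis.

(** * Random graphs with a small vertex cover *)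

Section Gnp.
Variables (R : realFieldType) (n : nat).
Implicit Types (p : R) (G : sgraph n) (P Q : sgraph n -> Prop) (S : {set 'I_n}).

(** Expanding the product on the right chooses [a e] or [b e] for each pair, that is, a graph. *)
Lemma sum_sgraph_prod (a b : {set 'I_n} -> R) :
  \sum_(G : sgraph n)
    \prod_(e : {set 'I_n} | #|e| == 2) (if e \in edges G then a e else b e) =
  \prod_(e : {set 'I_n} | #|e| == 2) (a e + b e).
Proof.
pose F (E : {set {set 'I_n}}) :=
  \prod_(e : {set 'I_n} | #|e| == 2) (if e \in E then a e else b e).
transitivity (\sum_(E : {set {set 'I_n}} | [forall e in E, #|e| == 2]) F E).
  rewrite [RHS](reindex_omap (@edges n) insub) => [|E EP] /=; last first.
    by rewrite insubT.
  by apply: eq_big => [G|G _]; rewrite ?valK ?eqxx ?andbT //; exact/esym/edges_pairs.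
rewrite [RHS]big_mkcond.
(* Off the pairs the values 0 and 1 kill every edge family containing a non-pair, so distributivity
   over all families of sets applies. *)
pose a' (e : {set 'I_n}) := if #|e| == 2 then a e else 0.
pose b' (e : {set 'I_n}) := if #|e| == 2 then b e else 1.
rewrite (eq_bigr (fun e => a' e + b' e)) => [|e _]; last first.
  by rewrite /a' /b'; case: ifP; rewrite // add0r.
rewrite bigA_distr big_mkcond; apply: eq_bigr => E _; case: ifPn => [E2|].
  rewrite /F big_mkcond; apply: eq_bigr => e _; rewrite /a' /b'.
  by case: ifPn => // /negP e2; case: ifP => // /(forall_inP E2).
rewrite negb_forall_in => /exists_inP[e eE e2].
by rewrite (bigD1 e) //= eE /a' (negPf e2) mul0r.
Qed.

Lemma Gnp_weight_ge0 p G : 0 <= p <= 1 -> 0 <= Gnp_weight p G.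
Proof.
move=> /andP[p0 p1]; apply: prodr_ge0 => e _; case: ifP => // _.
by rewrite subr_ge0.
Qed.

Lemma Gnp_weight_sum p : \sum_(G : sgraph n) Gnp_weight p G = 1.
Proof. by rewrite sum_sgraph_prod big1 // => e _; rewrite addrC subrK. Qed.

Lemma Gnp_probC p P : Gnp_prob p P = 1 - Gnp_prob p (fun G => ~ P G).
Proof.
rewrite -(Gnp_weight_sum p) (bigID (fun G => `[< P G >])) /= /Gnp_prob.
by under [X in _ - X]eq_bigl do rewrite asbool_neg; rewrite addrK.
Qed.

Definition independent G S := [forall e in edges G, ~~ (e \subset S)].

(** The indicator of the event is absorbed by giving weight 0 to edges inside S. The product formula
    then has a factor 1 - p for each pair inside S and p + (1 - p) = 1 for every other pair. *)
Lemma Gnp_prob_independent p S :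
  Gnp_prob p (fun G => independent G S) = (1 - p) ^+ 'C(#|S|, 2).
Proof.
rewrite /Gnp_prob.
transitivity (\sum_(G : sgraph n) \prod_(e : {set 'I_n} | #|e| == 2)
   (if e \in edges G then (if e \subset S then 0 else p) else 1 - p)).
  rewrite big_mkcond; apply: eq_bigr => G _; case: asboolP.
    move=> /forall_inP ind; apply: eq_bigr => e _.
    by case: ifP => // /ind /negPf ->.
  move=> /negP; rewrite negb_forall_in => /exists_inP[e eG]; rewrite negbK => eS.
  have /forall_inP/(_ e eG) e2 := edges_pairs G.
  by rewrite (bigD1 e) //= eG eS mul0r.
rewrite sum_sgraph_prod -cards_draws -prodr_const.
rewrite (bigID (fun e : {set 'I_n} => e \subset S)) /= [X in _ * X]big1 ?mulr1.
  by apply: eq_big => [e|e /andP[_ ->]]; rewrite ?inE ?add0r // andbC.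
by move=> e /andP[_ /negPf ->]; rewrite addrC subrK.
Qed.

Lemma Gnp_prob_le p P Q : 0 <= p <= 1 -> (forall G, P G -> Q G) ->
  Gnp_prob p P <= Gnp_prob p Q.
Proof.
move=> p01 PQ; rewrite /Gnp_prob big_mkcond [leRHS]big_mkcond.
apply: ler_sum => G _; case: asboolP => [/PQ QG|_].
  by case: asboolP.
by case: ifP => // _; exact: Gnp_weight_ge0.
Qed.

Lemma Gnp_prob_union p (I : finType) (A : pred I) (P : I -> sgraph n -> Prop) :
  0 <= p <= 1 ->
  Gnp_prob p (fun G => exists2 i, A i & P i G) <= \sum_(i | A i) Gnp_prob p (P i).
Proof.
move=> p01; under [leRHS]eq_bigr do rewrite /Gnp_prob big_mkcond.
rewrite /Gnp_prob big_mkcond exchange_big; apply: ler_sum => G _ /=.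
case: asboolP => [[i Ai PiG]|_].
  rewrite (bigD1 i) //= asboolT // lerDl sumr_ge0 // => j _.
  by case: ifP => // _; exact: Gnp_weight_ge0.
by apply: sumr_ge0 => j _; case: ifP => // _; exact: Gnp_weight_ge0.
Qed.

(** The complement of a minimum vertex cover is independent. *)
Lemma tau_half_independent G : (tau G * 2 <= n)%N ->
  exists2 S : {set 'I_n}, (uphalf n <= #|S|)%N & independent G S.
Proof.
rewrite /tau; case: arg_minnP => [|C /forall_inP GC _ Cn].
  exact: vertex_cover_setT.
exists (~: C)%SET; first by have := cardsC C; rewrite card_ord; lia.
apply/forall_inP => e /GC; apply: contraNN => /fintype.subsetP eC.
apply/eqP/setP => i; rewrite !inE; apply/negP => /andP[iC /eC].
by rewrite inE iC.
Qed.

Lemma Gnp_prob_tau p : 0 <= p <= 1 ->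
  Gnp_prob p (fun G => is_true (tau G * 2 <= n)%N) <=
  2 ^+ n * (1 - p) ^+ 'C(uphalf n, 2).
Proof.
move=> p01.
apply: le_trans (Gnp_prob_le p01 (@tau_half_independent)) _.
apply: le_trans (Gnp_prob_union _ _ p01) _.
have q01 : 0 <= 1 - p <= 1 by lra.
apply: (@le_trans _ _ (\sum_(S : {set 'I_n} | (uphalf n <= #|S|)%N)
   (1 - p) ^+ 'C(uphalf n, 2))).
  apply: ler_sum => S nS; rewrite Gnp_prob_independent.
  by apply: ler_wiXn2l; rewrite ?leq_bin2l //; lra.
rewrite sumr_const -[_ *+ #|_|]mulr_natl.
apply: ler_wpM2r; first by apply: exprn_ge0; lra.
rewrite -natrX ler_nat (leq_trans (max_card _)) //.
by rewrite -cardsT -powersetT card_powerset cardsT card_ord.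
Qed.

(** At p = 1/2 the law is uniform on labelled graphs, which links the random graph to counting
    isomorphism classes. *)
Lemma Gnp_prob_half P : Gnp_prob (2^-1 : R) P =
  #|[pred G | `[< P G >]]|%:R / 2 ^+ 'C(n, 2).
Proof.
rewrite /Gnp_prob (eq_bigr (fun=> (2^-1) ^+ 'C(n, 2))) => [|G _].
  by rewrite sumr_const -[_ *+ #|_|]mulr_natl exprVn.
rewrite /Gnp_weight (eq_bigr (fun=> 2^-1)) => [|e _].
  rewrite prodr_const; congr (_ ^+ _).
  by rewrite -[in RHS](card_ord n) -card_draws; apply: eq_card => e; rewrite inE.
by case: ifP => // _; lra.
Qed.

End Gnp.

(** * From labelled graphs to isomorphism classes *)

Section Iso_classes.
Variables (R : realFieldType) (n : nat).
Implicit Types (G H : sgraph n) (s t : 'S_n) (E : {set {set 'I_n}}).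

Definition edges_perm s E : {set {set 'I_n}} :=
  [set s @: (e : {set 'I_n}) | e in E]%SET.

Lemma edges_perm1 E : edges_perm 1 E = E.
Proof.
rewrite /edges_perm -[RHS]imset_id; apply: eq_imset => e.
by rewrite -[RHS]imset_id; apply: eq_imset => i; rewrite perm1.
Qed.

Lemma edges_permM s t E : edges_perm (s * t) E = edges_perm t (edges_perm s E).
Proof.
rewrite /edges_perm -imset_comp; apply: eq_imset => e /=.
by rewrite -imset_comp; apply: eq_imset => i /=; rewrite permM.
Qed.

Lemma graph_isoP G H :
  reflect (exists s, edges H = edges_perm s (edges G)) (graph_iso G H).
Proof. exact: 'exists_eqP. Qed.

Lemma graph_iso_refl : reflexive (@graph_iso n).
Proof. by move=> G; apply/graph_isoP; exists 1%g; rewrite edges_perm1. Qed.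

Lemma graph_iso_sym : symmetric (@graph_iso n).
Proof.
apply: symmetric_from_pre => G H /graph_isoP[s e]; apply/graph_isoP.
by exists s^-1%g; rewrite e -edges_permM mulgV edges_perm1.
Qed.

Lemma graph_iso_trans : transitive (@graph_iso n).
Proof.
move=> H G K /graph_isoP[s e] /graph_isoP[t f]; apply/graph_isoP.
by exists (s * t)%g; rewrite f e edges_permM.
Qed.

Lemma iso_classes_partition : finset.partition (iso_classes n) [set: sgraph n]%SET.
Proof.
apply: equivalence_partitionP => G H K _ _ _; split; first exact: graph_iso_refl.
by move=> GH; exact: (sym_left_transitive graph_iso_sym graph_iso_trans GH).
Qed.

(** A class is an orbit of the symmetric group acting on edge sets. *)
Lemma card_iso_class c : c \in iso_classes n -> (#|c| <= n`!)%N.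
Proof.
case/imsetP => G _ ->.
rewrite -(card_Sn n) -cardsT -(card_imset _ val_inj).
apply: leq_trans (leq_imset_card (edges_perm^~ (edges G)) _).
apply/subset_leq_card/fintype.subsetP => _ /imsetP[H + ->].
rewrite inE => /andP[_ /graph_isoP[s e]].
by apply/imsetP; exists s.
Qed.

Lemma card_sgraph_le : (#|{: sgraph n}| <= #|iso_classes n| * n`!)%N.
Proof.
rewrite -cardsT (card_partition iso_classes_partition) -sum_nat_const.
exact: leq_sum card_iso_class.
Qed.

(** With M classes, N labelled graphs and B bad labelled graphs, there are at most B bad classes and
    N <= n! M, so the bad fraction of classes is at most B / M <= n! B / N. *)
Lemma iso_class_prob_ge P :
  1 - n`!%:R * Gnp_prob (2^-1 : R) (fun G : sgraph n => ~ P G) <= iso_class_prob R P.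
Proof.
set M : R := #|iso_classes n|%:R; set N : R := 2 ^+ 'C(n, 2).
have N0 : 0 < N by rewrite exprn_gt0.
(* The number of labelled graphs is read off from the total probability 1 at p = 1/2. *)
have NE : N = #|{: sgraph n}|%:R.
  have := Gnp_prob_half R (fun _ : sgraph n => True).
  rewrite /Gnp_prob (eq_bigl predT) => [|G]; last by rewrite asboolT.
  rewrite Gnp_weight_sum => /esym /(canRL (divfK (lt0r_neq0 N0))).
  rewrite mul1r => <-; congr (_%:R).
  by apply: eq_card => G; rewrite !inE asboolT.
have NM : N <= n`!%:R * M.
  by rewrite NE -natrM ler_nat mulnC card_sgraph_le.
have M0 : 0 < M.
  rewrite lt_neqAle ler0n andbT; apply: contraTneq N0 => M0.
  by rewrite -leNgt (le_trans NM) // -M0 mulr0.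
rewrite Gnp_prob_half -/N /iso_class_prob -/M.
set good := [set c in _ | _]%SET; set B : R := #|_|%:R.
have badB : M - #|good|%:R <= B.
  rewrite lerBlDl -natrD ler_nat.
  rewrite -(cardsID good (iso_classes n)).
  rewrite leq_add ?subset_leq_card ?finset.subsetIr //.
  (* Each bad class is the block of some bad graph in it, so the block map from bad graphs covers
     the bad classes. *)
  apply: leq_trans
    (leq_imset_card (finset.pblock (iso_classes n)) [pred G | `[< ~ P G >]]).
  apply/subset_leq_card/fintype.subsetP => c; rewrite !inE => /andP[+ cI].
  rewrite cI negb_forall_in => /exists_inP[G Gc /asboolPn nPG].
  have /and3P[_ triv _] := iso_classes_partition.
  apply/imsetP; exists G; first exact/asboolP.
  exact/esym/finset.def_pblock.
rewrite lerBlDl -lerBlDr.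
have -> : 1 - #|good|%:R / M = (M - #|good|%:R) / M.
  by rewrite mulrBl divff // gt_eqF.
rewrite ler_pdivrMr // (le_trans badB) //.
rewrite mulrAC mulrA ler_pdivlMr // [leRHS]mulrC ler_wpM2l // ?ler0n //.
Qed.

Lemma iso_class_prob_le1 P : iso_class_prob R (P : sgraph n -> Prop) <= 1 :> R.
Proof.
rewrite /iso_class_prob; have [->|c0] := eqVneq #|iso_classes n| 0%N.
  by rewrite invr0 mulr0.
rewrite ler_pdivrMr ?ltr0n ?lt0n // mul1r ler_nat subset_leq_card //.
by apply/fintype.subsetP => c; rewrite inE => /andP[].
Qed.

End Iso_classes.

(** * Asymptotics *)

(* Loaded only here: the notations of [normedtype] clash with those of [mpoly]. *)
From mathcomp Require Import reals topology normedtype sequences.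
Import numFieldNormedType.Exports.
Local Open Scope classical_set_scope.
Local Open Scope ring_scope.

Lemma leq_fact_expn n : (n`! <= n ^ n)%N.
Proof.
rewrite fact_prod big_add1 /= big_mkord -[X in (n ^ X)%N]card_ord -prod_nat_const.
by apply: leq_prod => i _; exact: ltn_ord.
Qed.

(** Each of the k + 1 terms of 1 + v + ... + v^k is at least v^k, and the sum is at most 1 / (1 -
    v). *)
Lemma natr_mul_expr_le (R : realFieldType) (v : R) k : 0 <= v < 1 ->
  k.+1%:R * v ^+ k <= (1 - v)^-1.
Proof.
move=> /andP[v0 v1]; rewrite -[leRHS]mul1r ler_pdivlMr ?subr_gt0 //.
apply: (@le_trans _ _ (1 - v ^+ k.+1)); last by rewrite lerBlDr lerDl exprn_ge0.
have := subrX1 v k.+1; rewrite -opprB => /(canRL opprK) ->.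
rewrite -mulNr opprB [leRHS]mulrC.
apply: ler_wpM2r; first by rewrite subr_ge0 ltW.
rewrite mulr_natl (_ : _ *+ _ = \sum_(i < k.+1) v ^+ k); last first.
  by rewrite sumr_const card_ord.
apply: ler_sum => i _; apply: ler_wiXn2l => //; first exact: ltW.
by rewrite -ltnS.
Qed.

Lemma cvg_sqr_geometric (R : realType) (q : R) : 0 <= q < 1 ->
  (fun k : nat => k.+1%:R ^+ 2 * q ^+ k) @ \oo --> (0 : R).
Proof.
move=> /andP[q0 q1].
(* With q = v^4, the sequence is ((k + 1) v^k)^2 (v^2)^k: a bounded factor times a geometric one. *)
pose v := Num.sqrt (Num.sqrt q).
have v0 : 0 <= v by exact: sqrtr_ge0.
have qE : q = v ^+ 4 by rewrite (exprM v 2 2) !sqr_sqrtr // sqrtr_ge0.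
have v1 : v < 1 by rewrite ltNge; apply/negP => /(exprn_ege1 4); rewrite -qE; lra.
have vv1 : `|v ^+ 2| < 1 by rewrite ger0_norm ?exprn_ge0 // exprn_ilt1.
have := cvg_geometric ((1 - v)^-1 ^+ 2) vv1.
apply: squeeze_cvgr; last exact: cvg_cst.
apply: nearW => k; rewrite mulr_ge0 ?exprn_ge0 //=.
rewrite qE (_ : _ * _ = (k.+1%:R * v ^+ k) ^+ 2 * (v ^+ 2) ^+ k); last first.
  by rewrite ![v ^+ _ ^+ k]exprAC; move: (v ^+ k) k.+1%:R => x y; ring.
rewrite ler_wpM2r ?exprn_ge0 // lerXn2r ?nnegrE ?mulr_ge0 ?exprn_ge0 ?invr_ge0 //.
  by lra.
by apply: natr_mul_expr_le; rewrite v0.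
Qed.

(** Let h = [uphalf n] and let j be the integer part of (h - 1)/2. Then n! 2^n <= (2n)^n <=
    (4h)^(2h), while the binomial exponent h(h - 1)/2 is at least jh. The sequence is thus at most
    ((4h)^2 q^j)^h, eventually at most 2^(-h). *)
Lemma cvg_fact_geometric (R : realType) (q : R) : 0 <= q < 1 ->
  (fun n : nat => n`!%:R * (2 ^+ n * q ^+ 'C(uphalf n, 2))) @ \oo --> (0 : R).
Proof.
move=> q01; have /andP[q0 q1] := q01.
have half1 : `|2^-1 : R| < 1 by rewrite ger0_norm; lra.
have uphalf_oo : uphalf @ \oo --> \oo.
  apply/cvgnyPge => A; near=> n.
  by have : (A.*2 <= n)%N by [near: n; exact: nbhs_infty_ge]; lia.
have := cvg_comp _ _ uphalf_oo (cvg_expr half1).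
apply: squeeze_cvgr; last exact: cvg_cst.
(* Since h <= 2(j + 1), (4h)^2 <= 64 (j + 1)^2; the tolerance 1/128 makes (4h)^2 q^j at most 1/2. *)
have /cvgrPdist_lt/(_ 128^-1) := cvg_sqr_geometric q01.
case=> [|K _ Kle]; first by lra.
near=> n; rewrite !mulr_ge0 ?exprn_ge0 //=.
(* This bound ensures j >= K and h > 0. *)
have : (K.*2.+2 <= uphalf n)%N by near: n; exact: (uphalf_oo _ (nbhs_infty_ge _)).
set h := uphalf n => hn; pose j := (h.-1)./2.
have hj : (h <= (j.+1).*2)%N by rewrite /j; lia.
have small : (4 * h%:R) ^+ 2 * q ^+ j <= 2^-1.
  have := Kle j; rewrite /= sub0r normrN => /(_ _)/ltW.
  rewrite ger0_norm ?mulr_ge0 ?exprn_ge0 // => H.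
  have {}H := H (ltac:(rewrite /j; lia)).
  apply: (@le_trans _ _ (64 * (j.+1%:R ^+ 2 * q ^+ j))); last by lra.
  rewrite mulrA ler_wpM2r ?exprn_ge0 // (_ : 64 = 8 ^+ 2); last by ring.
  rewrite -exprMn lerXn2r ?nnegrE ?mulr_ge0 //.
  rewrite (_ : 8 = 4 * 2); last by ring.
  rewrite -mulrA ler_wpM2l // -natrM ler_nat mul2n //.
apply: (@le_trans _ _ (((4 * h%:R) ^+ 2 * q ^+ j) ^+ h)); last first.
  by rewrite lerXn2r ?nnegrE ?mulr_ge0 ?exprn_ge0 ?mulr_ge0 ?invr_ge0.
rewrite exprMn mulrA ler_pM ?mulr_ge0 ?exprn_ge0 //.
  rewrite -!exprM -natrX -!natrM -natrX ler_nat.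
  apply: (@leq_trans ((2 * n) ^ n)%N).
    by rewrite expnMn mulnC leq_mul2l leq_fact_expn orbT.
  apply: (@leq_trans ((4 * h) ^ n)%N).
    by rewrite leq_exp2r; rewrite /h; lia.
  by rewrite leq_pexp2l; rewrite /h; lia.
rewrite -exprM; apply: ler_wiXn2l => //; first exact: ltW.
rewrite bin2 -[(j * h)%N]doubleK half_leq // doubleMl mulnC leq_mul2l.
by apply/orP; right; rewrite /j; lia.
Unshelve. all: by end_near.
Qed.

Lemma Gnp_prob_not_WLP (k : fieldType) (R : realFieldType) (p : R) n :
  [pchar k] =i pred0 -> 0 <= p <= 1 ->
  Gnp_prob p (fun G : sgraph n => ~ Ac_WLP k G) <=
  2 ^+ n * (1 - p) ^+ 'C(uphalf n, 2).
Proof.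
move=> k0 p01; apply: le_trans (Gnp_prob_tau n p01).
apply: Gnp_prob_le => // G; apply: contra_notT; rewrite -ltnNge.
exact: Ac_WLP_tau.
Qed.

Lemma cvg1_squeeze (R : realType) (u v : nat -> R) :
  (forall n, 1 - v n <= u n <= 1) -> v @ \oo --> (0 : R) -> u @ \oo --> (1 : R).
Proof.
move=> uv v0.
have : (fun n => 1 - v n) @ \oo --> (1 - 0 : R) by apply: cvgB v0; exact: cvg_cst.
rewrite subr0 => v1; apply: squeeze_cvgr v1 _; last exact: cvg_cst.
exact: nearW.
Qed.

Theorem theorem1p2 (k : fieldType) (hk : [pchar k] =i pred0) :
  (forall (n : nat) (G : sgraph n),
     edges G != finset.set0 -> (n%:R / 2%:R < (tau G)%:R :> rat) ->
     Ac_WLP k G) /\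
  (forall (R : realType) (p : R), 0 <= p <= 1 ->
     ((fun n : nat => Gnp_prob p (fun G : sgraph n => Ac_WLP k G))
        @ \oo --> (1 : R)) /\
     ((fun n : nat => iso_class_prob R (fun G : sgraph n => Ac_WLP k G))
        @ \oo --> (1 : R))).
Proof.
split=> [n G _ tauG|R p p01].
  apply: Ac_WLP_tau => //; move: tauG.
  by rewrite ltr_pdivrMr ?ltr0n // -natrM ltr_nat.
split.
  (* At p = 0 the union bound is 2^n, which is useless; instead, only the edgeless graph has nonzero
     weight. *)
  have [p0|p0] := eqVneq p 0.
    have one n : Gnp_prob p (fun G : sgraph n => Ac_WLP k G) = 1.
      rewrite Gnp_probC [X in 1 - X]big1 ?subr0 // => G /asboolP nWLP.
      have [G0|[e eG]] := set_0Vmem (edges G).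
        by case: nWLP; exact: Ac_WLP_no_edge.
      have /forall_inP/(_ e eG) e2 := edges_pairs G.
      by rewrite /Gnp_weight (bigD1 e) //= eG p0 mul0r.
    by under eq_fun do rewrite one; exact: cvg_cst.
  have q01 : 0 <= 1 - p < 1.
    by move: p01 => /andP[pge0 p1]; rewrite subr_ge0 p1 /= gtrBl lt0r p0.
  (* The bound is inflated by the factor n! >= 1, so that the same limit serves here and for random
     classes. *)
  apply: cvg1_squeeze (cvg_fact_geometric q01) => n.
  rewrite Gnp_probC lerB //=; last first.
    apply: le_trans (Gnp_prob_not_WLP _ hk p01) _.
    rewrite ler_peMl ?mulr_ge0 ?exprn_ge0 //; first by lra.
    by rewrite ler1n fact_gt0.
  rewrite gerBl; apply: sumr_ge0 => G _; exact: Gnp_weight_ge0.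
have h01 : 0 <= (2^-1 : R) <= 1 by lra.
have q01 : 0 <= 1 - (2^-1 : R) < 1 by lra.
apply: cvg1_squeeze (cvg_fact_geometric q01) => n.
rewrite iso_class_prob_le1 andbT.
apply: le_trans (iso_class_prob_ge _ _); rewrite lerB // ler_wpM2l ?ler0n //.
exact: Gnp_prob_not_WLP.
Qed.
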